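(* Let $D$ be any dataset, let $g$ be a data transformer with values in $\mathbb{Z}^r$, and let $\eta\in\mathbb{R}^r$ be any fixed noise perturbation vector. Let $j^*\in\{1,\dots,r\}$ be the index of the current largest count of $g(D)$, i.e. $g(D)_{j^*}=\max_i g(D)_i$, and let $e_{j^*}$ be the $j^*$-th standard basis vector of $\mathbb{R}^r$. Then the noisy argmax is immutable once a sufficiently large constant is added to the largest count: there exists $C>0$ (depending on $g(D)$ and $\eta$) such that for every $c\ge C$, $$\operatorname*{arg\,max}_{1\le i\le r}\ \bigl(g(D)+c\,e_{j^*}+\eta\bigr)_i = j^*,$$ the maximizer being unique.
   Context: A data transformer is a function $g$ that maps each dataset $D$ to an integer vector (a vector of counts) $g(D)\in\mathbb{Z}^r$, where $r\ge 1$ is the dimension of the vector. The noisy argmax of a count vector, for a given noise vector, is the index of the largest entry of the count vector plus the noise vector. Immutable means that the argmax is unaffected by the noise added. If several indices attain the largest count of $g(D)$, $j^*$ denotes one fixed such index (the one to whose count the constant is added). *)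

(* Defs.v *)
From mathcomp Require Import all_boot all_order all_algebra.
From mathcomp Require Import reals.

Set Implicit Arguments.
Unset Strict Implicit.
Unset Printing Implicit Defensive.

Import Order.TTheory GRing.Theory Num.Theory.
Local Open Scope ring_scope.

(* Set-valued, so that "j is the unique maximizer of v" reads
   [argmax v = [set j]]. *)
Definition argmax (K : realDomainType) (r : nat) (v : 'rV[K]_r) : {set 'I_r} :=
  [set j | [forall i, v 0 i <= v 0 j]].

Definition noisy_argmax (R : realType) (r : nat) (q eta : 'rV[R]_r) :
    {set 'I_r} :=
  argmax (q + eta).

(* Main.v *)
Require Import Defs.
From mathcomp Require Import all_boot all_order all_algebra.
From mathcomp Require Import reals.
From mathcomp Require Import lra.

Import Order.TTheory GRing.Theory Num.Theory.
Local Open Scope ring_scope.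

(** Since [jstar] already has the largest count, a rival [i] can overtake it only through the noise
    gap [eta 0 i - eta 0 jstar]. A constant [c] above all these gaps makes entry [jstar] strictly
    dominant, which by [argmax_eq1] leaves no other maximizer. *)

Lemma argmax_eq1 (K : realDomainType) (r : nat) (v : 'rV[K]_r) (j : 'I_r) :
  (forall i, i != j -> v 0 i < v 0 j) -> argmax v = [set j].
Proof.
move=> lt_vj; apply/setP=> k; rewrite !inE.
have [->|neq_kj] := eqVneq k j.
  apply/forallP=> i; have [->//|/lt_vj/ltW//] := eqVneq i j.
by apply/negbTE/forallPn; exists j; rewrite -ltNge lt_vj.
Qed.

Theorem lemma3p1 (R : realType) (r : nat) (hr : (1 <= r)%N)
    (Dataset : Type) (g : Dataset -> 'rV[int]_r) (D : Dataset)
    (eta : 'rV[R]_r) (jstar : 'I_r) (hjstar : jstar \in argmax (g D)) :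
  exists2 C : R, 0 < C &
    forall c : R, C <= c ->
      noisy_argmax (map_mx intr (g D) + c *: delta_mx 0 jstar) eta
        = [set jstar].
Proof.
(* The sum bounds all noise gaps at once; the added 1 makes [C] positive and the domination
   strict. *)
exists (1 + \sum_i `|eta 0 i - eta 0 jstar|).
  by rewrite ltr_pwDl ?ltr01 ?sumr_ge0.
move=> c le_Cc; apply: argmax_eq1 => i neq_ij.
have le_g : (g D 0 i)%:~R <= (g D 0 jstar)%:~R :> R.
  by move: hjstar; rewrite inE ler_int => /forallP.
have le_eta : eta 0 i - eta 0 jstar <= \sum_k `|eta 0 k - eta 0 jstar|.
  rewrite (le_trans (ler_norm _)) // (bigD1 i) //=.
  by rewrite lerDl sumr_ge0.
rewrite !mxE !eqxx (negbTE neq_ij) /= mulr0 mulr1.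
(* The count gap is at most 0 and the noise gap at most [c - 1]. *)
lra.
Qed.
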